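(* Let $p,q,r$ be positive real numbers such that $0<r<\frac1q$ and $p>\max\{1,\frac1q\}$. There exists a constant $\lambda_0>0$ such that for every $\lambda\in(0,\lambda_0)$ the boundary value problem $$-u''=\lambda|v|^{r-1}v+|v|^{p-1}v,\qquad -v''=|u|^{q-1}u\qquad\text{in }(0,1),$$ $$u(0)=u(1)=0,\qquad v(0)=v(1)=0,$$ possesses at least two distinct nontrivial nonnegative classical solutions $(u,v)$.
   Context: For $s>0$ the expression $|t|^{s-1}t$ is understood to be $0$ at $t=0$. A nonnegative classical solution is a pair $(u,v)$ with $u,v\in C^2(0,1)\cap C[0,1]$ and $u,v\ge 0$ in $(0,1)$ such that the equations and boundary conditions hold pointwise. Nontrivial means $(u,v)\not\equiv(0,0)$. *)

(* Defs.v *)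
From Stdlib Require Import Reals.
From Coquelicot Require Import Coquelicot.
Open Scope R_scope.

(* The function t |-> |t|^(s-1) t.  At t = 0 the factor [Rpower 0 (s - 1)]
   carries no meaning, but it is a real number, so the product is 0 there, as
   the convention for |t|^(s-1) t requires. *)
Definition signed_pow (s t : R) : R := Rpower (Rabs t) (s - 1) * t.

(* Functions on [0,1] are represented by total functions on R, of which only
   the values on [0,1] matter.  In [C2_open] the order k = 1 is needed besides
   k = 2: [Derive] is total, so [ex_derive_n f 2 x] alone does not make f
   differentiable. *)
Definition C2_open (f : R -> R) : Prop :=
  forall x : R, 0 < x < 1 ->
  forall k : nat, (k <= 2)%nat ->
    ex_derive_n f k x /\ continuous (Derive_n f k) x.

(* Continuity relative to [0,1], hence one-sided at the endpoints. *)
Definition C0_closed (f : R -> R) : Prop :=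
  continuous_on (fun x : R => 0 <= x <= 1) f.

Record nonneg_classical_solution (p q r lambda : R) (u v : R -> R) : Prop := {
  sol_u_C2 : C2_open u;
  sol_v_C2 : C2_open v;
  sol_u_C0 : C0_closed u;
  sol_v_C0 : C0_closed v;
  sol_u_ge0 : forall x : R, 0 < x < 1 -> 0 <= u x;
  sol_v_ge0 : forall x : R, 0 < x < 1 -> 0 <= v x;
  sol_u_eq : forall x : R, 0 < x < 1 ->
    - Derive_n u 2 x = lambda * signed_pow r (v x) + signed_pow p (v x);
  sol_v_eq : forall x : R, 0 < x < 1 ->
    - Derive_n v 2 x = signed_pow q (u x);
  sol_u_bc : u 0 = 0 /\ u 1 = 0;
  sol_v_bc : v 0 = 0 /\ v 1 = 0
}.

Definition same_on_unit (u1 v1 u2 v2 : R -> R) : Prop :=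
  forall x : R, 0 <= x <= 1 -> u1 x = u2 x /\ v1 x = v2 x.

Definition nontrivial (u v : R -> R) : Prop :=
  ~ same_on_unit u v (fun _ => 0) (fun _ => 0).

(* Main.v *)
Require Import Defs.
From Stdlib Require Import Reals Lra Lia Classical IndefiniteDescription.
From Coquelicot Require Import Coquelicot.
Open Scope R_scope.

(** The two solutions are found by shooting from the middle of the interval.
    Write [f v = lambda * v ^ r + v ^ p] and [g u = u ^ q] for nonnegative
    arguments and extend both by 0.  Move the midpoint to the origin and look
    for even solutions: prescribe [u 0 = a], [v 0 = b], [u' 0 = v' 0 = 0], and
    try to make [u] and [v] vanish simultaneously at time 1/2.

    The initial value problem is equivalent to [u = a - J (f v)],
    [v = b - J (g u)], where [J] is the double integral from 0 ([shoot]).  It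
    is monotone: increasing [a] or decreasing [b] raises [u] and lowers [v].
    Hence the solution [sol] is a limit of monotone iterates.  It is unique
    although [f] and [g] may fail to be Lipschitz at 0 ([ordered_unique]): where
    both components are positive they are Lipschitz, and once one of them
    reaches 0 it exerts no force any more.  Uniqueness and monotonicity together
    give continuity in [(a, b)], by squeezing ([corner_continuous]).

    For every [b] there is exactly one [a = alpha b] for which [u] vanishes at
    time 1/2, because the end value of [u] increases with [a] at rate at least
    1.  Let [endval b] be the corresponding value of [v] at time 1/2.  It is
    continuous in [b], and its positive zeros are the central values of
    solutions of the boundary value problem; these are nonnegative because both
    components decrease away from the centre.  Two estimates give its signs:
    - [endval 1 > 0] when [lambda < 1], because [f 1 <= 2] makes the total fall
      of [v] less than 1 ([endval_pos]);
    - [endval b < 0] whenever [b] is below a fixed multiple of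
      [(f (b / 2)) ^ q], by concavity ([endval_neg]).  For small [b] this holds because of
      the term [lambda * v ^ r], as [r * q < 1]; for large [b] because of the
      term [v ^ p], as [p * q > 1].
    So [endval] has a zero on each side of 1 ([centred_solution]), and the two
    solutions differ at the midpoint.  Any [lambda0 <= 1] works. *)

(** * Single and double integrals *)

Definition cont (h : R -> R) : Prop := forall x, continuous h x.

Lemma continuous_eps (f : R -> R) (x : R) :
  continuous f x <->
  forall eps, 0 < eps -> exists d, 0 < d /\
    forall y, Rabs (y - x) < d -> Rabs (f y - f x) < eps.
Proof.
  split.
  - intros H eps He.
    destruct (proj1 (filterlim_locally _ _) H (mkposreal eps He)) as [d Hd].
    exists d; split; [apply cond_pos | exact Hd].
  - intros H. apply filterlim_locally. intros eps.
    destruct (H eps (cond_pos eps)) as [d [Hd Hf]].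
    exists (mkposreal d Hd). exact Hf.
Qed.

Lemma cont_const (c : R) : cont (fun _ => c).
Proof. intros x. apply continuous_const. Qed.

Lemma cont_comp (f h : R -> R) : cont f -> cont h -> cont (fun x => f (h x)).
Proof. intros Hf Hh x. apply (continuous_comp h f); [apply Hh | apply Hf]. Qed.

Lemma cont_minus (f h : R -> R) :
  cont f -> cont h -> cont (fun x => f x - h x).
Proof. intros Hf Hh x. apply (continuous_minus f h); [apply Hf | apply Hh]. Qed.

Lemma cont_opp_arg (h : R -> R) : cont h -> cont (fun x => h (- x)).
Proof.
  intros Hh. apply cont_comp; [exact Hh |].
  intros x. apply (continuous_opp (V := R_NormedModule) (fun y : R => y)).
  apply continuous_id.
Qed.

Definition prim (h : R -> R) (t : R) : R := RInt h 0 t.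

Lemma ex_RInt_cont (h : R -> R) (a b : R) : cont h -> ex_RInt h a b.
Proof. intros H. apply (ex_RInt_continuous (V := R_CompleteNormedModule)). auto. Qed.

Lemma prim_derive (h : R -> R) (t : R) : cont h -> is_derive (prim h) t (h t).
Proof.
  intros H. apply (is_derive_RInt h (prim h) 0 t); [| apply H].
  exists (mkposreal 1 Rlt_0_1). intros y _.
  apply (RInt_correct (V := R_CompleteNormedModule)), ex_RInt_cont, H.
Qed.

Lemma prim_cont (h : R -> R) : cont h -> cont (prim h).
Proof.
  intros H x. apply (ex_derive_continuous (prim h)).
  exists (h x). apply prim_derive, H.
Qed.

Lemma prim_0 (h : R -> R) : prim h 0 = 0.
Proof. apply (RInt_point (V := R_CompleteNormedModule)). Qed.

Lemma prim_le (h k : R -> R) (t : R) :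
  cont h -> cont k -> 0 <= t -> (forall s, 0 <= s <= t -> h s <= k s) ->
  prim h t <= prim k t.
Proof.
  intros Hh Hk Ht H. apply RInt_le; try apply ex_RInt_cont; auto.
  intros x Hx. apply H. lra.
Qed.

Lemma prim_const (c t : R) : prim (fun _ => c) t = c * t.
Proof.
  unfold prim. rewrite RInt_const. unfold scal; simpl; unfold mult; simpl. ring.
Qed.

Lemma prim_minus (h k : R -> R) (t : R) :
  cont h -> cont k -> prim (fun s => h s - k s) t = prim h t - prim k t.
Proof.
  intros Hh Hk.
  apply (RInt_minus (V := R_CompleteNormedModule) h k); apply ex_RInt_cont; auto.
Qed.

Lemma prim_opp_arg (h : R -> R) (t : R) :
  cont h -> prim h (- t) = - prim (fun s => h (- s)) t.
Proof.
  intros H.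
  assert (E : is_RInt (fun y => opp (h (- y))) 0 t (prim h (- t))).
  { apply (is_RInt_comp_opp h 0 t). rewrite Ropp_0.
    apply (RInt_correct (V := R_CompleteNormedModule)), ex_RInt_cont, H. }
  apply (is_RInt_unique (V := R_CompleteNormedModule)) in E. rewrite <- E.
  apply (RInt_opp (V := R_CompleteNormedModule) (fun s => h (- s))).
  apply ex_RInt_cont, cont_opp_arg, H.
Qed.

Lemma prim_ext (h k : R -> R) (t : R) :
  (forall s, Rabs s <= Rabs t -> h s = k s) -> prim h t = prim k t.
Proof.
  intros H. apply (RInt_ext (V := R_CompleteNormedModule)). intros x Hx. apply H.
  revert Hx. unfold Rmin, Rmax, Rabs.
  destruct (Rle_dec 0 t), (Rcase_abs x), (Rcase_abs t); lra.
Qed.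

Lemma prim_ge0 (h : R -> R) (t : R) :
  cont h -> 0 <= t -> (forall s, 0 <= s <= t -> 0 <= h s) -> 0 <= prim h t.
Proof.
  intros Hh Ht H. replace 0 with (prim (fun _ => 0) t)
    by (rewrite prim_const; ring).
  apply prim_le; auto using cont_const.
Qed.

Lemma prim_incr (h : R -> R) (s t : R) :
  cont h -> 0 <= s <= t -> (forall x, s <= x <= t -> 0 <= h x) ->
  prim h s <= prim h t.
Proof.
  intros Hh Hst H. unfold prim.
  rewrite <- (RInt_Chasles (V := R_CompleteNormedModule) h 0 s t)
    by (apply ex_RInt_cont; auto).
  assert (0 <= RInt h s t).
  { apply RInt_ge_0; [lra | apply ex_RInt_cont; auto | intros; apply H; lra]. }
  unfold plus; simpl. lra.
Qed.

Lemma prim_abs_le (h : R -> R) (t e : R) :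
  cont h -> (forall s, Rabs s <= Rabs t -> Rabs (h s) <= e) ->
  Rabs (prim h t) <= Rabs t * e.
Proof.
  assert (P : forall k u, cont k -> 0 <= u ->
    (forall s, Rabs s <= u -> Rabs (k s) <= e) -> Rabs (prim k u) <= u * e).
  { intros k u Hk Hu H. replace (u * e) with ((u - 0) * e) by ring.
    apply abs_RInt_le_const; [auto | apply ex_RInt_cont; auto |].
    intros s Hs. apply H. rewrite Rabs_pos_eq; lra. }
  intros Hh H. destruct (Rle_dec 0 t) as [Ht | Ht].
  - rewrite (Rabs_pos_eq t) in * by auto. apply P; auto.
  - rewrite (Rabs_left t) in * by lra.
    replace t with (- (- t)) at 1 by ring.
    rewrite prim_opp_arg, Rabs_Ropp by auto.
    apply P; [apply cont_opp_arg; auto | lra |].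
    intros s Hs. apply H. rewrite Rabs_Ropp. auto.
Qed.

(** [J h] is the solution of [y'' = h], [y 0 = y' 0 = 0]. *)
Definition J (h : R -> R) (t : R) : R := prim (prim h) t.

Lemma J_cont (h : R -> R) : cont h -> cont (J h).
Proof. intros H. apply prim_cont, prim_cont, H. Qed.

Lemma J_opp_arg (h : R -> R) (t : R) :
  cont h -> J h (- t) = J (fun s => h (- s)) t.
Proof.
  intros H. unfold J. rewrite prim_opp_arg by (apply prim_cont, H).
  rewrite (prim_ext (fun s => prim h (- s)) (fun s => 0 - prim (fun x => h (- x)) s)).
  - rewrite prim_minus; [rewrite prim_const; ring | apply cont_const |].
    apply prim_cont, cont_opp_arg, H.
  - intros s _. rewrite prim_opp_arg by auto. ring.
Qed.

Lemma J_even (h : R -> R) (t : R) :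
  cont h -> (forall s, h (- s) = h s) -> J h (- t) = J h t.
Proof.
  intros H E. rewrite J_opp_arg by auto.
  apply prim_ext. intros s _. apply prim_ext. intros x _. apply E.
Qed.

Lemma J_minus (h k : R -> R) (t : R) :
  cont h -> cont k -> J (fun s => h s - k s) t = J h t - J k t.
Proof.
  intros Hh Hk. unfold J.
  rewrite <- prim_minus by (apply prim_cont; auto).
  apply prim_ext. intros s _. apply prim_minus; auto.
Qed.

Lemma J_le_right (h k : R -> R) (t : R) :
  cont h -> cont k -> 0 <= t -> (forall s, 0 <= s <= t -> h s <= k s) ->
  J h t <= J k t.
Proof.
  intros Hh Hk Ht H. apply prim_le; auto using prim_cont.
  intros s Hs. apply prim_le; auto; [lra |]. intros x Hx. apply H. lra.
Qed.

Lemma J_le (h k : R -> R) (t : R) :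
  cont h -> cont k -> (forall s, h s <= k s) -> J h t <= J k t.
Proof.
  intros Hh Hk H. destruct (Rle_dec 0 t) as [Ht | Ht].
  - apply J_le_right; auto.
  - replace t with (- (- t)) by ring.
    rewrite (J_opp_arg h (- t)), (J_opp_arg k (- t)) by auto.
    apply J_le_right; auto using cont_opp_arg. lra.
Qed.

Lemma J_zero (t : R) : J (fun _ => 0) t = 0.
Proof.
  unfold J. rewrite (prim_ext _ (fun _ => 0)), prim_const; [ring |].
  intros s _. rewrite prim_const. ring.
Qed.

Lemma J_ge0 (h : R -> R) (t : R) :
  cont h -> (forall s, 0 <= h s) -> 0 <= J h t.
Proof.
  intros Hh H. rewrite <- (J_zero t). apply J_le; auto using cont_const.
Qed.

Lemma J_incr (h : R -> R) (s t : R) :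
  cont h -> (forall x, 0 <= x <= t -> 0 <= h x) -> 0 <= s <= t ->
  J h s <= J h t.
Proof.
  intros Hh H Hst. apply prim_incr; auto using prim_cont.
  intros x Hx. apply prim_ge0; auto; [lra |]. intros; apply H; lra.
Qed.

(** [J h] is convex when [h >= 0]: its derivative [prim h] increases, so the
    chord over [[s, t]] is at least as steep as the tangent at [s]. *)
Lemma J_slope (h : R -> R) (s t : R) :
  cont h -> (forall x, 0 <= x <= t -> 0 <= h x) -> 0 <= s <= t ->
  prim h s * (t - s) <= J h t - J h s.
Proof.
  intros Hh H Hst. change (J h t) with (RInt (prim h) 0 t).
  change (J h s) with (RInt (prim h) 0 s).
  rewrite <- (RInt_Chasles (V := R_CompleteNormedModule) (prim h) 0 s t)
    by (apply ex_RInt_cont; apply prim_cont; auto).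
  assert (RInt (fun _ => prim h s) s t <= RInt (prim h) s t).
  { apply RInt_le; try (apply ex_RInt_cont; auto using prim_cont, cont_const);
      [lra |]. intros x Hx. apply prim_incr; auto; [lra |].
    intros; apply H; lra. }
  rewrite RInt_const in H0. unfold scal in H0; simpl in H0; unfold mult in H0; simpl in H0.
  unfold plus; simpl. lra.
Qed.

Lemma J_le_prim (h : R -> R) (t : R) :
  cont h -> 0 <= t -> (forall x, 0 <= x <= t -> 0 <= h x) ->
  J h t <= t * prim h t.
Proof.
  intros Hh Ht H. replace (t * prim h t) with (prim (fun _ => prim h t) t)
    by (rewrite prim_const; ring).
  apply prim_le; auto using prim_cont, cont_const.
  intros s Hs. apply prim_incr; auto. intros; apply H; lra.
Qed.

Lemma J_le_const (h : R -> R) (t c : R) :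
  cont h -> 0 <= t -> (forall x, 0 <= x <= t -> 0 <= h x <= c) ->
  J h t <= t * t * c.
Proof.
  intros Hh Ht H.
  apply Rle_trans with (t * prim h t).
  - apply J_le_prim; auto. intros; apply H; auto.
  - assert (prim h t <= c * t).
    { rewrite <- prim_const. apply prim_le; auto using cont_const.
      intros; apply H; auto. }
    nra.
Qed.

(** Convexity of [J h] between its zero at 0 and the point [2 t]. *)
Lemma J_half (h : R -> R) (t : R) :
  cont h -> 0 <= t -> (forall x, 0 <= x <= 2 * t -> 0 <= h x) ->
  2 * J h t <= J h (2 * t).
Proof.
  intros Hh Ht H.
  assert (A : prim h t * (2 * t - t) <= J h (2 * t) - J h t)
    by (apply J_slope; auto; lra).
  assert (B : J h t <= t * prim h t).
  { apply J_le_prim; auto. intros; apply H; lra. }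
  lra.
Qed.

(** A lower bound for [h] near 0 already forces [J h] to be large at the far
    end, because the slope gained on [[0, t]] is kept on [[t, 2 t]]. *)
Lemma J_lower (h : R -> R) (t c : R) :
  cont h -> 0 <= t -> (forall x, 0 <= x <= 2 * t -> 0 <= h x) ->
  (forall x, 0 <= x <= t -> c <= h x) -> t * t * c <= J h (2 * t).
Proof.
  intros Hh Ht H Hc.
  assert (A : prim h t * (2 * t - t) <= J h (2 * t) - J h t)
    by (apply J_slope; auto; lra).
  assert (B : 0 <= J h t).
  { rewrite <- (J_zero t). apply J_le_right; auto using cont_const.
    intros; apply H; lra. }
  assert (C : c * t <= prim h t).
  { rewrite <- prim_const. apply prim_le; auto using cont_const. }
  nra.
Qed.

Lemma J_lipschitz (h : R -> R) (C M s t : R) :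
  cont h -> (forall x, Rabs (h x) <= C) -> Rabs s <= M -> Rabs t <= M ->
  Rabs (J h t - J h s) <= M * C * Rabs (t - s).
Proof.
  intros Hh HC Hs Ht.
  destruct (MVT_gen (J h) s t (prim h)) as [c [Hc E]].
  - intros x _. apply prim_derive, prim_cont, Hh.
  - intros x _. apply continuity_pt_filterlim, J_cont, Hh.
  - rewrite E, Rabs_mult. apply Rmult_le_compat_r; [apply Rabs_pos |].
    assert (Rabs c <= M).
    { revert Hc Hs Ht. unfold Rmin, Rmax. destruct (Rle_dec s t);
        intros; apply Rabs_le; apply Rabs_le_between in Hs, Ht; lra. }
    apply Rle_trans with (Rabs c * C); [apply prim_abs_le; auto |].
    apply Rmult_le_compat_r; auto.
    apply Rle_trans with (Rabs (h 0)); [apply Rabs_pos | auto].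
Qed.

Lemma prim_diff_le (h : R -> R) (c s t : R) :
  cont h -> s <= t -> (forall x, s <= x <= t -> h x <= c) ->
  prim h t - prim h s <= c * (t - s).
Proof.
  intros Hh Hst H. unfold prim.
  rewrite <- (RInt_Chasles (V := R_CompleteNormedModule) h 0 s t)
    by (apply ex_RInt_cont; auto).
  assert (RInt h s t <= RInt (fun _ => c) s t).
  { apply RInt_le; try (apply ex_RInt_cont; auto using cont_const); auto.
    intros; apply H; lra. }
  rewrite RInt_const in H0. unfold scal in H0; simpl in H0; unfold mult in H0; simpl in H0.
  unfold plus; simpl. lra.
Qed.

Lemma J_small (h : R -> R) (tau t c : R) :
  cont h -> 0 <= tau <= t -> (forall s, 0 <= s <= t -> 0 <= h s) ->
  (forall s, 0 <= s <= tau -> h s <= 0) ->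
  (forall s, tau <= s <= t -> h s <= c) ->
  J h t <= t * (c * (t - tau)).
Proof.
  intros Hh Ht H0 Hz Hc.
  assert (A : prim h tau <= 0 * (tau - 0)).
  { replace (prim h tau) with (prim h tau - prim h 0) by (rewrite prim_0; ring).
    apply prim_diff_le; auto; lra. }
  assert (B : prim h t - prim h tau <= c * (t - tau))
    by (apply prim_diff_le; auto; lra).
  apply Rle_trans with (t * prim h t); [apply J_le_prim; auto; lra |].
  apply Rmult_le_compat_l; lra.
Qed.

Lemma J_nonpos (h : R -> R) (t : R) :
  cont h -> 0 <= t -> (forall s, 0 <= s <= t -> h s <= 0) -> J h t <= 0.
Proof.
  intros Hh Ht H. rewrite <- (J_zero t). apply J_le_right; auto using cont_const.
Qed.

(** Gronwall's inequality in the form that uniqueness needs: two nonnegative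
    functions vanish up to [tau] and then each is Lipschitz-controlled by the
    double integral of the other.  On a short enough interval past [tau] each
    double integral is at most half of the other, so both are 0.  Monotonicity
    of [J] makes the values at one time [t] control everything before [t]. *)
Lemma coupled_J_zero (h k : R -> R) (tau L d : R) :
  cont h -> cont k -> (forall s, 0 <= s -> 0 <= h s) ->
  (forall s, 0 <= s -> 0 <= k s) ->
  0 <= tau -> 0 <= L -> 0 < d ->
  (forall s, 0 <= s <= tau -> h s <= 0 /\ k s <= 0) ->
  (forall s, tau <= s < tau + d -> h s <= L * J k s /\ k s <= L * J h s) ->
  exists t, tau < t < tau + d /\ J h t <= 0 /\ J k t <= 0.
Proof.
  intros Hh Hk Ph Pk Htau HL Hd Hz Hlip.
  (* With this step, the contraction factor [(tau + e) * L * e] is at most 1/2. *)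
  pose (e := Rmin (d / 2) (/ (2 * (L + 1) * (tau + d)))).
  assert (Pe : 0 < e).
  { apply Rmin_pos; [lra |]. apply Rinv_0_lt_compat.
    apply Rmult_lt_0_compat; lra. }
  pose proof (Rmin_l (d / 2) (/ (2 * (L + 1) * (tau + d)))) as E1.
  pose proof (Rmin_r (d / 2) (/ (2 * (L + 1) * (tau + d)))) as E2.
  fold e in E1, E2.
  assert (E3 : e * ((L + 1) * (tau + d)) <= / 2).
  { apply Rle_trans with
      (/ (2 * (L + 1) * (tau + d)) * ((L + 1) * (tau + d))).
    - apply Rmult_le_compat_r; auto. apply Rmult_le_pos; lra.
    - right. field. lra. }
  exists (tau + e). split; [lra |].
  assert (Ih : 0 <= J h (tau + e)).
  { rewrite <- (J_zero (tau + e)). apply J_le_right; auto using cont_const; try lra.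
    intros; apply Ph; lra. }
  assert (Ik : 0 <= J k (tau + e)).
  { rewrite <- (J_zero (tau + e)). apply J_le_right; auto using cont_const; try lra.
    intros; apply Pk; lra. }
  assert (A : J h (tau + e) <= (tau + e) * ((L * J k (tau + e)) * (tau + e - tau))).
  { apply J_small; auto; [lra | intros; apply Ph; lra | intros; apply Hz; auto |].
    intros s Hs. apply Rle_trans with (L * J k s); [apply Hlip; lra |].
    apply Rmult_le_compat_l; auto. apply J_incr; auto; [| lra].
    intros; apply Pk; lra. }
  assert (B : J k (tau + e) <= (tau + e) * ((L * J h (tau + e)) * (tau + e - tau))).
  { apply J_small; auto; [lra | intros; apply Pk; lra | intros; apply Hz; auto |].
    intros s Hs. apply Rle_trans with (L * J h s); [apply Hlip; lra |].
    apply Rmult_le_compat_l; auto. apply J_incr; auto; [| lra].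
    intros; apply Ph; lra. }
  assert (K : (tau + e) * L * e <= / 2).
  { apply Rle_trans with (e * ((L + 1) * (tau + d))); auto.
    rewrite (Rmult_comm _ e). apply Rmult_le_compat_l; [lra |].
    rewrite Rmult_comm. apply Rmult_le_compat; lra. }
  set (x := J h (tau + e)) in *. set (y := J k (tau + e)) in *.
  replace ((tau + e) * (L * y * (tau + e - tau))) with (((tau + e) * L * e) * y)
    in A by ring.
  replace ((tau + e) * (L * x * (tau + e - tau))) with (((tau + e) * L * e) * x)
    in B by ring.
  assert ((tau + e) * L * e * y <= / 2 * y) by (apply Rmult_le_compat_r; auto).
  assert ((tau + e) * L * e * x <= / 2 * x) by (apply Rmult_le_compat_r; auto).
  lra.
Qed.

(** * Continuous convergence of sequences of functions *)

(** Continuous convergence.  On compact intervals it amounts to uniform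
    convergence, but composing with a continuous function preserves it for
    trivial reasons, with no appeal to uniform continuity. *)
Definition cconv (h_ : nat -> R -> R) (h : R -> R) : Prop :=
  forall x eps, 0 < eps -> exists (N : nat) (d : R), 0 < d /\
    forall n y, (N <= n)%nat -> Rabs (y - x) < d -> Rabs (h_ n y - h x) < eps.

Lemma cconv_pointwise (h_ : nat -> R -> R) (h : R -> R) (x : R) :
  cconv h_ h -> is_lim_seq (fun n => h_ n x) (h x).
Proof.
  intros H. apply is_lim_seq_spec. intros eps.
  destruct (H x eps (cond_pos eps)) as [N [d [Hd HN]]].
  exists N. intros n Hn. apply HN; auto.
  rewrite Rminus_diag, Rabs_R0. auto.
Qed.

Lemma cconv_comp (f : R -> R) (h_ : nat -> R -> R) (h : R -> R) :
  cont f -> cconv h_ h -> cconv (fun n x => f (h_ n x)) (fun x => f (h x)).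
Proof.
  intros Hf H x eps He.
  destruct (proj1 (continuous_eps f (h x)) (Hf (h x)) eps He) as [e [He' Hfe]].
  destruct (H x e He') as [N [d [Hd HN]]].
  exists N, d. split; auto.
Qed.

Lemma cconv_const_minus (a_ : nat -> R) (a : R) (h_ : nat -> R -> R) (h : R -> R) :
  is_lim_seq a_ a -> cconv h_ h ->
  cconv (fun n x => a_ n - h_ n x) (fun x => a - h x).
Proof.
  intros Ha H x eps He.
  destruct (proj2 (is_lim_seq_spec _ _) Ha (mkposreal (eps / 2) ltac:(lra)))
    as [N1 H1].
  destruct (H x (eps / 2) ltac:(lra)) as [N [d [Hd HN]]].
  exists (N + N1)%nat, d. split; auto. intros n y Hn Hy.
  specialize (H1 n ltac:(lia)). specialize (HN n y ltac:(lia) Hy).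
  simpl in H1. apply Rabs_lt_between in H1, HN.
  apply Rabs_lt_between. lra.
Qed.

Lemma cconv_uniform (h_ : nat -> R -> R) (h : R -> R) (a b eps : R) :
  cont h -> cconv h_ h -> 0 < eps ->
  exists N : nat, forall n x, (N <= n)%nat -> a <= x <= b ->
    Rabs (h_ n x - h x) < eps.
Proof.
  intros Hc H He.
  (* One positive number attached to [x] records both a radius and, through
     its inverse, a rank: a positive lower bound on these numbers over a
     finite cover then bounds the ranks. *)
  assert (L : forall x, exists d : posreal, forall n y,
    / (INR n + 1) < d -> Rabs (y - x) < d -> Rabs (h_ n y - h y) < eps).
  { intros x. destruct (H x (eps / 2) ltac:(lra)) as [N [d [Hd HN]]].
    destruct (proj1 (continuous_eps h x) (Hc x) (eps / 2) ltac:(lra))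
      as [d' [Hd' HN']].
    assert (PN : 0 < / (INR N + 1)).
    { apply Rinv_0_lt_compat. pose proof (pos_INR N). lra. }
    assert (Pd : 0 < Rmin (Rmin d d') (/ (INR N + 1)))
      by (repeat apply Rmin_pos; auto).
    exists (mkposreal _ Pd). simpl. intros n y Hn Hy.
    pose proof (Rmin_l (Rmin d d') (/ (INR N + 1))).
    pose proof (Rmin_r (Rmin d d') (/ (INR N + 1))).
    pose proof (Rmin_l d d'). pose proof (Rmin_r d d').
    assert (Hn' : (N <= n)%nat).
    { apply INR_le. destruct (Rle_dec (INR N) (INR n)) as [|C]; auto.
      exfalso. assert (/ (INR N + 1) < / (INR n + 1)); [| lra].
      pose proof (pos_INR n). pose proof (pos_INR N).
      apply Rinv_lt_contravar; nra. }
    specialize (HN n y Hn' ltac:(lra)). specialize (HN' y ltac:(lra)).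
    apply Rabs_lt_between in HN, HN'. apply Rabs_lt_between. lra. }
  pose (delta x := proj1_sig (constructive_indefinite_description _ (L x))).
  assert (Ldelta : forall x n y, / (INR n + 1) < delta x ->
    Rabs (y - x) < delta x -> Rabs (h_ n y - h y) < eps).
  { intros x. exact (proj2_sig (constructive_indefinite_description _ (L x))). }
  destruct (compactness_value_1d a b delta) as [d Hd].
  destruct (nfloor_ex (/ d)) as [N HN].
  { apply Rlt_le, Rinv_0_lt_compat, cond_pos. }
  exists N. intros n x Hn Hx. apply NNPP. intros C.
  apply (Hd x Hx). intros [t [_ [Ht Hdt]]]. apply C, (Ldelta t); auto.
  apply Rlt_le_trans with d; auto.
  pose proof (cond_pos d). pose proof (le_INR _ _ Hn).
  rewrite <- (Rinv_inv d). apply Rinv_lt_contravar; [| lra].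
  assert (0 < / d) by (apply Rinv_0_lt_compat, cond_pos). nra.
Qed.

Lemma cconv_prim (h_ : nat -> R -> R) (h : R -> R) :
  (forall n, cont (h_ n)) -> cont h -> cconv h_ h ->
  cconv (fun n => prim (h_ n)) (prim h).
Proof.
  intros Hc_ Hc H x eps He.
  pose (M := Rabs x + 1).
  assert (HM : 0 < M) by (unfold M; pose proof (Rabs_pos x); lra).
  destruct (cconv_uniform h_ h (- M) M (eps / (2 * M)) Hc H) as [N HN].
  { apply Rdiv_lt_0_compat; lra. }
  destruct (proj1 (continuous_eps (prim h) x) (prim_cont h Hc x) (eps / 2)
    ltac:(lra)) as [d [Hd HD]].
  exists N, (Rmin d 1). split; [apply Rmin_pos; lra |]. intros n y Hn Hy.
  pose proof (Rmin_l d 1). pose proof (Rmin_r d 1).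
  specialize (HD y ltac:(lra)).
  assert (My : Rabs y <= M).
  { unfold M. replace y with (x + (y - x)) by ring.
    pose proof (Rabs_triang x (y - x)). lra. }
  assert (A : Rabs (prim (fun s => h_ n s - h s) y) <= eps / 2).
  { apply Rle_trans with (Rabs y * (eps / (2 * M))).
    - apply prim_abs_le; [apply cont_minus; auto |].
      intros s Hs. apply Rlt_le, HN; auto. apply Rabs_le_between. lra.
    - apply Rle_trans with (M * (eps / (2 * M))).
      + apply Rmult_le_compat_r; auto. apply Rlt_le, Rdiv_lt_0_compat; lra.
      + right. field. lra. }
  rewrite prim_minus in A by auto.
  replace (prim (h_ n) y - prim h x)
    with ((prim (h_ n) y - prim h y) + (prim h y - prim h x)) by ring.
  eapply Rle_lt_trans; [apply Rabs_triang | lra].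
Qed.

Lemma cconv_J (h_ : nat -> R -> R) (h : R -> R) :
  (forall n, cont (h_ n)) -> cont h -> cconv h_ h ->
  cconv (fun n => J (h_ n)) (J h).
Proof.
  intros Hc_ Hc H.
  apply (cconv_prim (fun n => prim (h_ n)) (prim h)); auto using prim_cont.
  apply cconv_prim; auto.
Qed.

(** The last step of the Arzela-Ascoli argument: local equi-Lipschitz bounds
    upgrade pointwise convergence.  Pointwise convergence itself will always
    come from monotonicity in [n], so no subsequences have to be extracted. *)
Lemma equilip_cconv (h_ : nat -> R -> R) (h : R -> R) :
  (forall M, 0 <= M -> exists L, 0 <= L /\ forall n s t,
    Rabs s <= M -> Rabs t <= M -> Rabs (h_ n t - h_ n s) <= L * Rabs (t - s)) ->
  (forall x, is_lim_seq (fun n => h_ n x) (h x)) -> cconv h_ h.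
Proof.
  intros HL Hp x eps He.
  destruct (HL (Rabs x + 1)) as [L [HL0 HL']].
  { pose proof (Rabs_pos x); lra. }
  destruct (proj2 (is_lim_seq_spec _ _) (Hp x) (mkposreal (eps / 2) ltac:(lra)))
    as [N HN]. simpl in HN.
  exists N, (Rmin 1 (eps / (2 * (L + 1)))). split.
  { apply Rmin_pos; [lra |]. apply Rdiv_lt_0_compat; lra. }
  intros n y Hn Hy.
  pose proof (Rmin_l 1 (eps / (2 * (L + 1)))).
  pose proof (Rmin_r 1 (eps / (2 * (L + 1)))).
  assert (A : Rabs (h_ n y - h_ n x) <= L * Rabs (y - x)).
  { apply HL'; [lra |]. replace y with (x + (y - x)) by ring.
    pose proof (Rabs_triang x (y - x)). lra. }
  assert (B : (L + 1) * Rabs (y - x) < eps / 2).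
  { apply Rlt_le_trans with ((L + 1) * (eps / (2 * (L + 1)))).
    - apply Rmult_lt_compat_l; lra.
    - right. field. lra. }
  specialize (HN n Hn). pose proof (Rabs_pos (y - x)).
  replace (h_ n y - h x) with ((h_ n y - h_ n x) + (h_ n x - h x)) by ring.
  eapply Rle_lt_trans; [apply Rabs_triang | nra].
Qed.

(** In [H y], the rank may be taken beyond the one attached to [x]; the same
    term of the sequence is then close to both [h x] and [h y]. *)
Lemma cconv_cont (h_ : nat -> R -> R) (h : R -> R) : cconv h_ h -> cont h.
Proof.
  intros H x. apply continuous_eps. intros eps He.
  destruct (H x (eps / 2) ltac:(lra)) as [N [d [Hd HN]]].
  exists d. split; auto. intros y Hy.
  destruct (H y (eps / 2) ltac:(lra)) as [N' [d' [Hd' HN']]].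
  specialize (HN (N + N')%nat y ltac:(lia) Hy).
  specialize (HN' (N + N')%nat y ltac:(lia)).
  rewrite Rminus_diag, Rabs_R0 in HN'. specialize (HN' Hd').
  apply Rabs_lt_between in HN, HN'. apply Rabs_lt_between. lra.
Qed.

(** * The largest solution of the initial value problem *)

(** What the shooting argument uses of the two right-hand sides.  Vanishing on
    the negative axis lets solutions be continued past their first zero, so
    that they all exist up to time 1/2.  No Lipschitz condition is imposed at
    0, where the powers with exponent below 1 have none. *)
Record nonlinearity (h : R -> R) : Prop := {
  nl_cont : cont h;
  nl_mono : forall x y, x <= y -> h x <= h y;
  nl_zero : forall x, x <= 0 -> h x = 0;
  nl_lip : forall x, 0 < x -> exists L d, 0 <= L /\ 0 < d /\
    forall y z, Rabs (y - x) < d -> Rabs (z - x) < d ->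
      Rabs (h y - h z) <= L * Rabs (y - z)
}.

Lemma nl_ge0 (h : R -> R) (x : R) : nonlinearity h -> 0 <= h x.
Proof.
  intros H. destruct (Rle_dec x 0).
  - rewrite nl_zero; auto. lra.
  - rewrite <- (nl_zero h H 0); [| lra]. apply nl_mono; auto. lra.
Qed.

(** The solution of [y'' = - h w], [y 0 = c], [y' 0 = 0].  A solution of the
    system is a pair with [u = shoot f a v] and [v = shoot g b u]. *)
Definition shoot (h : R -> R) (c : R) (w : R -> R) (t : R) : R :=
  c - J (fun s => h (w s)) t.

Lemma shoot_0 (h : R -> R) (c : R) (w : R -> R) : shoot h c w 0 = c.
Proof. unfold shoot, J. rewrite prim_0. ring. Qed.

Lemma shoot_cont (h : R -> R) (c : R) (w : R -> R) :
  nonlinearity h -> cont w -> cont (shoot h c w).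
Proof.
  intros Hh Hw.
  apply (cont_minus (fun _ => c)); [apply cont_const |].
  apply J_cont, cont_comp; auto using nl_cont.
Qed.

Lemma shoot_anti (h : R -> R) (c1 c2 : R) (w1 w2 : R -> R) (t : R) :
  nonlinearity h -> cont w1 -> cont w2 -> c2 <= c1 ->
  (forall s, w1 s <= w2 s) -> c1 - c2 <= shoot h c1 w1 t - shoot h c2 w2 t.
Proof.
  intros Hh H1 H2 Hc Hw.
  assert (J (fun s => h (w1 s)) t <= J (fun s => h (w2 s)) t).
  { apply J_le; try (apply cont_comp; auto using nl_cont).
    intros s. apply nl_mono; auto. }
  unfold shoot. lra.
Qed.

Lemma shoot_le (h : R -> R) (c : R) (w : R -> R) (t : R) :
  nonlinearity h -> cont w -> shoot h c w t <= c.
Proof.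
  intros Hh Hw.
  assert (0 <= J (fun s => h (w s)) t).
  { apply J_ge0; [apply cont_comp; auto using nl_cont |].
    intros; apply nl_ge0; auto. }
  unfold shoot. lra.
Qed.

Lemma shoot_even (h : R -> R) (c : R) (w : R -> R) (t : R) :
  nonlinearity h -> cont w -> (forall s, w (- s) = w s) ->
  shoot h c w (- t) = shoot h c w t.
Proof.
  intros Hh Hw E. unfold shoot. rewrite J_even; auto.
  - apply cont_comp; auto using nl_cont.
  - intros s. rewrite E. auto.
Qed.

Lemma shoot_decr (h : R -> R) (c : R) (w : R -> R) (s t : R) :
  nonlinearity h -> cont w -> 0 <= s <= t -> shoot h c w t <= shoot h c w s.
Proof.
  intros Hh Hw Hst.
  assert (J (fun x => h (w x)) s <= J (fun x => h (w x)) t).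
  { apply J_incr; auto; [apply cont_comp; auto using nl_cont |].
    intros; apply nl_ge0; auto. }
  unfold shoot. lra.
Qed.

Lemma shoot_lipschitz (h : R -> R) (c : R) (w : R -> R) (A M s t : R) :
  nonlinearity h -> cont w -> (forall x, w x <= A) ->
  Rabs s <= M -> Rabs t <= M ->
  Rabs (shoot h c w t - shoot h c w s) <= M * h A * Rabs (t - s).
Proof.
  intros Hh Hw HA Hs Ht. unfold shoot.
  rewrite Rabs_minus_sym.
  replace (c - J (fun x => h (w x)) s - (c - J (fun x => h (w x)) t))
    with (J (fun x => h (w x)) t - J (fun x => h (w x)) s) by ring.
  apply J_lipschitz; auto; [apply cont_comp; auto using nl_cont |].
  intros x. rewrite Rabs_pos_eq by (apply nl_ge0; auto). apply nl_mono; auto.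
Qed.

Lemma shoot_cconv (h : R -> R) (c_ : nat -> R) (c : R)
    (w_ : nat -> R -> R) (w : R -> R) :
  nonlinearity h -> (forall n, cont (w_ n)) -> cont w ->
  is_lim_seq c_ c -> cconv w_ w ->
  cconv (fun n => shoot h (c_ n) (w_ n)) (shoot h c w).
Proof.
  intros Hh Hc_ Hc Hlim H.
  apply cconv_const_minus; auto.
  apply (cconv_J (fun n s => h (w_ n s))).
  - intros n. apply cont_comp; auto using nl_cont.
  - apply cont_comp; auto using nl_cont.
  - apply cconv_comp; auto using nl_cont.
Qed.

(** The map [v |-> shoot g b (shoot f a v)] is a composition of two decreasing
    maps, hence increasing.  Iterating it from the constant [b], an upper bound
    of its range, gives a decreasing sequence whose limit is the largest
    solution [v] with central values [(a, b)]. *)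
Fixpoint iter (f g : R -> R) (a b : R) (n : nat) : R -> R :=
  match n with
  | O => fun _ => b
  | S m => shoot g b (shoot f a (iter f g a b m))
  end.

Definition sol (f g : R -> R) (a b t : R) : R :=
  real (Lim_seq (fun n => iter f g a b n t)).

Definition sol_u (f g : R -> R) (a b : R) : R -> R := shoot f a (sol f g a b).

Lemma shoot2_mono (f g : R -> R) (a1 a2 b1 b2 : R) (w1 w2 : R -> R) (t : R) :
  nonlinearity f -> nonlinearity g -> cont w1 -> cont w2 ->
  a2 <= a1 -> b1 <= b2 -> (forall s, w1 s <= w2 s) ->
  shoot g b1 (shoot f a1 w1) t <= shoot g b2 (shoot f a2 w2) t.
Proof.
  intros Hf Hg H1 H2 Ha Hb Hw.
  assert (b2 - b1 <= shoot g b2 (shoot f a2 w2) t - shoot g b1 (shoot f a1 w1) t).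
  { apply shoot_anti; auto using shoot_cont. intros s.
    assert (a1 - a2 <= shoot f a1 w1 s - shoot f a2 w2 s)
      by (apply shoot_anti; auto). lra. }
  lra.
Qed.

Section LargestSolution.
Context (f g : R -> R) (Hf : nonlinearity f) (Hg : nonlinearity g).

Lemma iter_cont (a b : R) (n : nat) : cont (iter f g a b n).
Proof.
  induction n as [| n IH]; simpl; [apply cont_const |].
  auto using shoot_cont.
Qed.

Lemma iter_decr (a b : R) (n : nat) (t : R) :
  iter f g a b (S n) t <= iter f g a b n t.
Proof.
  revert t. induction n as [| n IH]; intros t.
  - simpl. apply shoot_le; auto using shoot_cont, cont_const.
  - change (shoot g b (shoot f a (iter f g a b (S n))) t
      <= shoot g b (shoot f a (iter f g a b n)) t).
    apply shoot2_mono; auto using iter_cont; lra.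
Qed.

(** Since every [shoot f a v] is at most [a], the component [v] cannot fall
    faster than under the constant force [g a]. *)
Lemma iter_lower (a b : R) (n : nat) (t : R) :
  shoot g b (fun _ => a) t <= iter f g a b n t.
Proof.
  destruct n as [| n]; simpl.
  - apply shoot_le; auto using cont_const.
  - assert (b - b <= shoot g b (shoot f a (iter f g a b n)) t
      - shoot g b (fun _ => a) t); [| lra].
    apply shoot_anti; auto using shoot_cont, cont_const, iter_cont; [lra |].
    intros s. apply shoot_le; auto using iter_cont.
Qed.

Lemma sol_lim (a b t : R) :
  is_lim_seq (fun n => iter f g a b n t) (sol f g a b t).
Proof.
  apply Lim_seq_correct', ex_finite_lim_seq_decr with (shoot g b (fun _ => a) t).
  - intros n. apply iter_decr.
  - intros n. apply iter_lower.
Qed.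

Lemma sol_cconv (a b : R) : cconv (iter f g a b) (sol f g a b).
Proof.
  apply equilip_cconv; [| intros; apply sol_lim].
  intros M HM. exists (M * g a).
  assert (0 <= M * g a) by (apply Rmult_le_pos; auto using nl_ge0).
  split; auto. intros [| n] s t Hs Ht; simpl.
  - rewrite Rminus_diag, Rabs_R0. apply Rmult_le_pos; auto. apply Rabs_pos.
  - apply shoot_lipschitz; auto using shoot_cont, iter_cont.
    intros x. apply shoot_le; auto using iter_cont.
Qed.

Lemma sol_cont (a b : R) : cont (sol f g a b).
Proof. apply (cconv_cont (iter f g a b)), sol_cconv. Qed.

Lemma sol_u_cont (a b : R) : cont (sol_u f g a b).
Proof. apply shoot_cont; auto using sol_cont. Qed.

Lemma sol_eq (a b t : R) : sol f g a b t = shoot g b (sol_u f g a b) t.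
Proof.
  pose proof (proj1 (is_lim_seq_incr_1 _ _) (sol_lim a b t)) as H1.
  assert (H2 : is_lim_seq (fun n => iter f g a b (S n) t)
    (shoot g b (sol_u f g a b) t)).
  { apply (cconv_pointwise (fun n => iter f g a b (S n))). simpl.
    apply (shoot_cconv g (fun _ => b) b (fun n => shoot f a (iter f g a b n)));
      auto using shoot_cont, iter_cont, sol_u_cont, is_lim_seq_const.
    apply (shoot_cconv f (fun _ => a) a (iter f g a b));
      auto using iter_cont, sol_cont, is_lim_seq_const, sol_cconv. }
  apply is_lim_seq_unique in H1, H2. rewrite H1 in H2. congruence.
Qed.

Lemma iter_even (a b : R) (n : nat) (t : R) :
  iter f g a b n (- t) = iter f g a b n t.
Proof.
  revert t. induction n as [| n IH]; intros t; simpl; auto.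
  apply shoot_even; auto using shoot_cont, iter_cont.
  intros s. apply shoot_even; auto using iter_cont.
Qed.

Lemma sol_even (a b t : R) : sol f g a b (- t) = sol f g a b t.
Proof.
  unfold sol. f_equal. apply Lim_seq_ext. intros n. apply iter_even.
Qed.

Lemma sol_u_even (a b t : R) : sol_u f g a b (- t) = sol_u f g a b t.
Proof. apply shoot_even; auto using sol_cont, sol_even. Qed.

Lemma sol_max (a b : R) (v : R -> R) (t : R) :
  cont v -> (forall s, v s = shoot g b (shoot f a v) s) -> v t <= sol f g a b t.
Proof.
  intros Hv Ev.
  assert (H : forall n s, v s <= iter f g a b n s).
  { induction n as [| n IH]; intros s; rewrite Ev; simpl.
    - apply shoot_le; auto using shoot_cont.
    - apply shoot2_mono; auto using iter_cont; lra. }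
  apply (is_lim_seq_le (fun _ => v t) (fun n => iter f g a b n t) (v t)
    (sol f g a b t)); auto using is_lim_seq_const, sol_lim.
Qed.

(** Raising [a] and lowering [b] raises [u] and lowers [v]: the system
    preserves the order of the cone [u >= 0 >= v]. *)
Lemma sol_mono (a1 a2 b1 b2 t : R) :
  a2 <= a1 -> b1 <= b2 -> sol f g a1 b1 t <= sol f g a2 b2 t.
Proof.
  intros Ha Hb.
  assert (H : forall n s, iter f g a1 b1 n s <= iter f g a2 b2 n s).
  { induction n as [| n IH]; intros s; simpl; auto.
    apply shoot2_mono; auto using iter_cont. }
  apply (is_lim_seq_le (fun n => iter f g a1 b1 n t) (fun n => iter f g a2 b2 n t)
    (sol f g a1 b1 t) (sol f g a2 b2 t)); auto using sol_lim.
Qed.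

(** The gap between the two [u] components never shrinks; this expansion makes
    the choice of [a] below unique and continuous. *)
Lemma sol_u_mono (a1 a2 b1 b2 t : R) :
  a2 <= a1 -> b1 <= b2 -> a1 - a2 <= sol_u f g a1 b1 t - sol_u f g a2 b2 t.
Proof.
  intros Ha Hb. apply shoot_anti; auto using sol_cont.
  intros s. apply sol_mono; auto.
Qed.
End LargestSolution.

(** * Uniqueness and continuous dependence on the central values *)

Lemma lub_closed (k : R -> R) (E : R -> Prop) (tau : R) :
  cont k -> is_lub E tau -> (forall t, E t -> k t <= 0) -> k tau <= 0.
Proof.
  intros Hk [Hub Hlub] H. apply Rnot_lt_le. intros C.
  destruct (proj1 (continuous_eps k tau) (Hk tau) (k tau) C) as [d [Hd HD]].
  assert (tau <= tau - d); [| lra].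
  apply Hlub. intros t Et. apply Rnot_lt_le. intros C'.
  pose proof (Hub t Et). specialize (H t Et).
  assert (D : Rabs (t - tau) < d) by (apply Rabs_lt_between; lra).
  specialize (HD t D). apply Rabs_lt_between in HD. lra.
Qed.

(** Uniqueness forward in time, although [f] and [g] need not be Lipschitz at
    0.  Let [tau] be the last time up to which the two solutions agree.  If [u]
    and [v] are both positive there, the Lipschitz bounds at positive arguments
    and Gronwall's inequality extend the agreement.  If one of them is not
    positive at [tau], it stays so, because it is nonincreasing, in both
    solutions; the force it exerts is then 0 in both, so they agree for ever.
    Comparing with an ordered pair of solutions suffices, since one solution is
    the largest. *)
Lemma ordered_unique (f g : R -> R) (a b : R) (v1 v2 : R -> R) (T : R) :
  nonlinearity f -> nonlinearity g -> cont v1 -> cont v2 ->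
  (forall t, v1 t = shoot g b (shoot f a v1) t) ->
  (forall t, v2 t = shoot g b (shoot f a v2) t) ->
  (forall t, v2 t <= v1 t) -> 0 <= T -> v1 T = v2 T.
Proof.
  intros Hf Hg C1 C2 E1 E2 Hv HT.
  set (u1 := shoot f a v1) in *. set (u2 := shoot f a v2) in *.
  assert (Cu1 : cont u1) by (apply shoot_cont; auto).
  assert (Cu2 : cont u2) by (apply shoot_cont; auto).
  assert (Hu : forall t, u1 t <= u2 t).
  { intros t. assert (a - a <= u2 t - u1 t) by (apply shoot_anti; auto; lra).
    lra. }
  set (h := fun s => f (v1 s) - f (v2 s)).
  set (k := fun s => g (u2 s) - g (u1 s)).
  assert (Cfv1 : cont (fun s => f (v1 s))) by (apply cont_comp; auto using nl_cont).
  assert (Cfv2 : cont (fun s => f (v2 s))) by (apply cont_comp; auto using nl_cont).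
  assert (Cgu1 : cont (fun s => g (u1 s))) by (apply cont_comp; auto using nl_cont).
  assert (Cgu2 : cont (fun s => g (u2 s))) by (apply cont_comp; auto using nl_cont).
  assert (Ch : cont h) by (apply cont_minus; auto).
  assert (Ck : cont k) by (apply cont_minus; auto).
  assert (Ph : forall s, 0 <= h s).
  { intros s. pose proof (nl_mono f Hf _ _ (Hv s)). unfold h. lra. }
  assert (Pk : forall s, 0 <= k s).
  { intros s. pose proof (nl_mono g Hg _ _ (Hu s)). unfold k. lra. }
  assert (Jh : forall t, J h t = u2 t - u1 t).
  { intros t. unfold h. rewrite J_minus by auto. unfold u1, u2, shoot. ring. }
  assert (Jk : forall t, J k t = v1 t - v2 t).
  { intros t. unfold k. rewrite J_minus by auto. rewrite E1, E2. unfold shoot. ring. }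
  pose (E t := 0 <= t <= T /\ J h t <= 0 /\ J k t <= 0).
  destruct (completeness E) as [tau Htau].
  - exists T. intros t Et. apply Et.
  - exists 0. unfold E, J. rewrite !prim_0. lra.
  - assert (B : 0 <= tau <= T).
    { destruct Htau as [Hub Hlub]. split.
      - apply Hub. unfold E, J. rewrite !prim_0. lra.
      - apply Hlub. intros t Et. apply Et. }
    assert (Zh : J h tau <= 0).
    { apply (lub_closed (J h) E); auto using J_cont. intros t Et. apply Et. }
    assert (Zk : J k tau <= 0).
    { apply (lub_closed (J k) E); auto using J_cont. intros t Et. apply Et. }
    assert (Eu : forall t s, 0 <= s <= t -> J h t <= 0 -> u1 s = u2 s).
    { intros t s Hs Hz. assert (J h s <= J h t) by (apply J_incr; auto).
      rewrite (Jh s) in H. pose proof (Hu s). lra. }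
    assert (Ev : forall t s, 0 <= s <= t -> J k t <= 0 -> v1 s = v2 s).
    { intros t s Hs Hz. assert (J k s <= J k t) by (apply J_incr; auto).
      rewrite (Jk s) in H. pose proof (Hv s). lra. }
    assert (Dv : forall s, tau <= s -> v1 s <= v1 tau).
    { intros s Hs. rewrite !E1. apply shoot_decr; auto. lra. }
    assert (Du : forall s, tau <= s -> u2 s <= u2 tau).
    { intros s Hs. apply shoot_decr; auto. lra. }
    destruct (Rle_dec (u2 tau) 0) as [Nu | Pu].
    { assert (Z : J k T <= 0).
      { apply J_nonpos; auto. intros s Hs. unfold k.
        destruct (Rle_dec s tau).
        - rewrite (Eu tau s); auto; lra.
        - pose proof (Du s ltac:(lra)). pose proof (Hu s).
          rewrite (nl_zero g Hg (u2 s)), (nl_zero g Hg (u1 s)); lra. }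
      rewrite Jk in Z. pose proof (Hv T). lra. }
    destruct (Rle_dec (v1 tau) 0) as [Nv | Pv].
    { assert (Z : J h T <= 0).
      { apply J_nonpos; auto. intros s Hs. unfold h.
        destruct (Rle_dec s tau).
        - rewrite (Ev tau s); auto; lra.
        - pose proof (Dv s ltac:(lra)). pose proof (Hv s).
          rewrite (nl_zero f Hf (v1 s)), (nl_zero f Hf (v2 s)); lra. }
      assert (Z' : J k T <= 0).
      { apply J_nonpos; auto. intros s Hs. unfold k.
        rewrite (Eu T s); auto; lra. }
      rewrite Jk in Z'. pose proof (Hv T). lra. }
    destruct (Req_dec tau T) as [-> | NT].
    { rewrite Jk in Zk. pose proof (Hv T). lra. }
    exfalso.
    destruct (nl_lip f Hf (v1 tau)) as [Lf [df [PLf [Pdf HLf]]]]; [lra |].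
    destruct (nl_lip g Hg (u2 tau)) as [Lg [dg [PLg [Pdg HLg]]]]; [lra |].
    assert (near : forall w c e, cont w -> w tau = c -> 0 < e ->
      exists d, 0 < d /\ forall s, Rabs (s - tau) < d -> Rabs (w s - c) < e).
    { intros w c e Hw <- He. apply continuous_eps; auto. }
    destruct (near v1 (v1 tau) df) as [d1 [P1 D1]]; auto.
    destruct (near v2 (v1 tau) df) as [d2 [P2 D2]]; auto.
    { symmetry. apply (Ev tau); auto; lra. }
    destruct (near u1 (u2 tau) dg) as [d3 [P3 D3]]; auto.
    { apply (Eu tau); auto; lra. }
    destruct (near u2 (u2 tau) dg) as [d4 [P4 D4]]; auto.
    pose (d := Rmin (Rmin (Rmin d1 d2) (Rmin d3 d4)) (T - tau)).
    assert (Pd : 0 < d) by (repeat apply Rmin_pos; auto; lra).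
    assert (Hd : d <= d1 /\ d <= d2 /\ d <= d3 /\ d <= d4 /\ d <= T - tau).
    { unfold d. pose proof (Rmin_l (Rmin (Rmin d1 d2) (Rmin d3 d4)) (T - tau)).
      pose proof (Rmin_r (Rmin (Rmin d1 d2) (Rmin d3 d4)) (T - tau)).
      pose proof (Rmin_l (Rmin d1 d2) (Rmin d3 d4)).
      pose proof (Rmin_r (Rmin d1 d2) (Rmin d3 d4)).
      pose proof (Rmin_l d1 d2). pose proof (Rmin_r d1 d2).
      pose proof (Rmin_l d3 d4). pose proof (Rmin_r d3 d4). lra. }
    destruct (coupled_J_zero h k tau (Lf + Lg) d) as [t [Ht [Zth Ztk]]];
      auto; try lra.
    + intros s Hs. unfold h, k.
      rewrite (Ev tau s), (Eu tau s); auto; lra.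
    + intros s Hs. rewrite Jh, Jk. unfold h, k.
      pose proof (Hu s). pose proof (Hv s).
      assert (A : Rabs (s - tau) < d) by (apply Rabs_lt_between; lra).
      specialize (HLf _ _ (D1 s ltac:(lra)) (D2 s ltac:(lra))).
      specialize (HLg _ _ (D4 s ltac:(lra)) (D3 s ltac:(lra))).
      rewrite (Rabs_pos_eq (v1 s - v2 s)) in HLf by lra.
      rewrite (Rabs_pos_eq (u2 s - u1 s)) in HLg by lra.
      apply Rabs_le_between in HLf, HLg.
      assert (0 <= Lg * (v1 s - v2 s)) by (apply Rmult_le_pos; lra).
      assert (0 <= Lf * (u2 s - u1 s)) by (apply Rmult_le_pos; lra).
      split; rewrite Rmult_plus_distr_r; lra.
    + assert (t <= tau); [| lra].
      apply Htau. unfold E. repeat split; auto; lra.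
Qed.

Section Dependence.
Context (f g : R -> R) (Hf : nonlinearity f) (Hg : nonlinearity g).

Lemma sol_unique (a b : R) (v : R -> R) (t : R) :
  cont v -> (forall s, v s = shoot g b (shoot f a v) s) -> 0 <= t ->
  sol f g a b t = v t.
Proof.
  intros Hv Ev Ht.
  exact (ordered_unique f g a b (sol f g a b) v t Hf Hg (sol_cont f g Hf Hg a b)
    Hv (sol_eq f g Hf Hg a b) Ev
    (fun s => sol_max f g Hf Hg a b v s Hv Ev) Ht).
Qed.

(** A convergent sequence of solutions converges to a solution, which is the
    expected one by uniqueness. *)
Lemma sol_seq_lim (a_ b_ : nat -> R) (a b A t : R) :
  is_lim_seq a_ a -> is_lim_seq b_ b -> (forall n, a_ n <= A) ->
  (forall x, ex_finite_lim_seq (fun n => sol f g (a_ n) (b_ n) x)) -> 0 <= t ->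
  is_lim_seq (fun n => sol f g (a_ n) (b_ n) t) (sol f g a b t) /\
  is_lim_seq (fun n => sol_u f g (a_ n) (b_ n) t) (sol_u f g a b t).
Proof.
  intros Ha Hb HA Hex Ht.
  set (v_ := fun n => sol f g (a_ n) (b_ n)).
  pose (v := fun x => real (Lim_seq (fun n => v_ n x))).
  assert (Hlim : forall x, is_lim_seq (fun n => v_ n x) (v x)).
  { intros x. apply Lim_seq_correct', Hex. }
  assert (Hv_ : forall n, cont (v_ n)) by (intros; apply sol_cont; auto).
  assert (Hcc : cconv v_ v).
  { apply equilip_cconv; auto.
    intros M HM. exists (M * g A).
    split; [apply Rmult_le_pos; auto using nl_ge0 |]. intros n s x Hs Hx.
    unfold v_. rewrite !sol_eq by auto.
    apply shoot_lipschitz; auto using sol_u_cont.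
    intros y. apply Rle_trans with (a_ n); auto. apply shoot_le; auto using sol_cont. }
  assert (Hv : cont v) by (apply (cconv_cont v_), Hcc).
  assert (Hccu : cconv (fun n => shoot f (a_ n) (v_ n)) (shoot f a v))
    by (apply shoot_cconv; auto).
  assert (Ev : forall x, v x = shoot g b (shoot f a v) x).
  { intros x. assert (H2 : is_lim_seq (fun n => v_ n x) (shoot g b (shoot f a v) x)).
    { apply (is_lim_seq_ext (fun n => shoot g (b_ n) (shoot f (a_ n) (v_ n)) x)).
      - intros n. symmetry. apply sol_eq; auto.
      - apply (cconv_pointwise (fun n => shoot g (b_ n) (shoot f (a_ n) (v_ n)))).
        apply (shoot_cconv g b_ b (fun n => shoot f (a_ n) (v_ n)));
          auto using shoot_cont. }
    pose proof (Hlim x) as H1. apply is_lim_seq_unique in H1, H2.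
    rewrite H1 in H2. congruence. }
  split.
  - rewrite (sol_unique a b v t); auto. apply Hlim.
  - assert (Eu : sol_u f g a b t = shoot f a v t).
    { unfold sol_u, shoot. f_equal.
      assert (Cs : cont (fun s => f (sol f g a b s)))
        by (apply cont_comp; auto using nl_cont, sol_cont).
      assert (Cv : cont (fun s => f (v s)))
        by (apply cont_comp; auto using nl_cont).
      apply Rle_antisym; apply J_le_right; auto; intros s Hs;
        rewrite (sol_unique a b v s); auto; lra. }
    rewrite Eu. apply (cconv_pointwise (fun n => shoot f (a_ n) (v_ n))), Hccu.
Qed.

Lemma inv_succ_lim : is_lim_seq (fun n => / (INR n + 1)) 0.
Proof.
  replace (Finite 0) with (Rbar_inv p_infty) by reflexivity.
  apply is_lim_seq_inv; [| discriminate].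
  apply (is_lim_seq_ext (fun n => INR (S n))).
  - intros n. apply S_INR.
  - apply (is_lim_seq_incr_1 INR), is_lim_seq_INR.
Qed.

Lemma inv_succ_bounds (n : nat) :
  0 < / (INR n + 1) <= 1 /\ / (INR (S n) + 1) <= / (INR n + 1).
Proof.
  pose proof (pos_INR n). rewrite S_INR. repeat split.
  - apply Rinv_0_lt_compat. lra.
  - rewrite <- Rinv_1. apply Rinv_le_contravar; lra.
  - apply Rinv_le_contravar; lra.
Qed.

Lemma plus_inv_succ_lim (c e : R) : is_lim_seq (fun n => c + e * / (INR n + 1)) c.
Proof.
  replace (Finite c) with (Finite (c + e * 0)) by (f_equal; ring).
  apply is_lim_seq_plus'; [apply is_lim_seq_const |].
  apply (is_lim_seq_scal_l (fun n => / (INR n + 1)) e 0), inv_succ_lim.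
Qed.

(** Along central values that tend to [(a, b)] from one corner of the order
    cone, the solutions are monotone in [n], hence convergent.  The sign [e]
    chooses the corner. *)
Lemma sol_corner_lim (a b e t : R) :
  e = 1 \/ e = -1 -> 0 <= t ->
  is_lim_seq (fun n => sol f g (a + e * / (INR n + 1)) (b + - e * / (INR n + 1)) t)
    (sol f g a b t) /\
  is_lim_seq (fun n => sol_u f g (a + e * / (INR n + 1)) (b + - e * / (INR n + 1)) t)
    (sol_u f g a b t).
Proof.
  intros He Ht.
  apply (sol_seq_lim (fun n => a + e * / (INR n + 1))
    (fun n => b + - e * / (INR n + 1)) a b (a + 1));
    auto using plus_inv_succ_lim.
  - intros n. destruct (inv_succ_bounds n). destruct He; subst e; lra.
  - intros x. destruct He as [-> | ->].
    + apply ex_finite_lim_seq_incr with (sol f g a b x);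
        intros n; destruct (inv_succ_bounds n); apply sol_mono; auto; lra.
    + apply ex_finite_lim_seq_decr with (sol f g a b x);
        intros n; destruct (inv_succ_bounds n); apply sol_mono; auto; lra.
Qed.

End Dependence.

Definition continuous2 (F : R -> R -> R) (a b : R) : Prop :=
  continuous (fun z : R * R => F (fst z) (snd z)) (a, b).

(** A function monotone for the cone order is squeezed near [(a, b)] between
    its values at two opposite corners of a small square. *)
Lemma corner_continuous (F : R -> R -> R) (a b : R) :
  (forall a1 a2 b1 b2, a2 <= a1 -> b1 <= b2 -> F a2 b2 <= F a1 b1) ->
  (forall e, e = 1 \/ e = -1 ->
    is_lim_seq (fun n => F (a + e * / (INR n + 1)) (b + - e * / (INR n + 1))) (F a b)) ->
  continuous2 F a b.
Proof.
  intros Hm Hl. apply filterlim_locally. intros eps.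
  destruct (proj2 (is_lim_seq_spec _ _) (Hl 1 ltac:(auto)) eps) as [N1 H1].
  destruct (proj2 (is_lim_seq_spec _ _) (Hl (-1) ltac:(auto)) eps) as [N2 H2].
  specialize (H1 (N1 + N2)%nat ltac:(lia)).
  specialize (H2 (N1 + N2)%nat ltac:(lia)).
  destruct (inv_succ_bounds (N1 + N2)) as [[Pd _] _].
  exists (mkposreal _ Pd). intros [a' b'] [Ha Hb]. simpl in Ha, Hb |- *.
  change (Rabs (a' - a) < / (INR (N1 + N2) + 1)) in Ha.
  change (Rabs (b' - b) < / (INR (N1 + N2) + 1)) in Hb.
  change (Rabs (F a' b' - F a b) < eps).
  apply Rabs_lt_between in Ha, Hb, H1, H2.
  set (d := / (INR (N1 + N2) + 1)) in *.
  pose proof (Hm (a + 1 * d) a' (b + - (1) * d) b' ltac:(lra) ltac:(lra)).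
  pose proof (Hm a' (a + -1 * d) b' (b + - -1 * d) ltac:(lra) ltac:(lra)).
  apply Rabs_lt_between. lra.
Qed.

(** * Shooting *)

(** Concavity: a solution component that is still nonnegative at time 1/2 keeps
    half of its central value up to time 1/4. *)
Lemma shoot_mid (h : R -> R) (c : R) (w : R -> R) (s : R) :
  nonlinearity h -> cont w -> 0 <= shoot h c w (1 / 2) -> 0 <= s <= 1 / 4 ->
  c / 2 <= shoot h c w s.
Proof.
  intros Hh Hw H0 Hs.
  assert (A : 2 * J (fun x => h (w x)) (1 / 4) <= J (fun x => h (w x)) (2 * (1 / 4))).
  { apply J_half; try lra; [apply cont_comp; auto using nl_cont |].
    intros; apply nl_ge0; auto. }
  replace (2 * (1 / 4)) with (1 / 2) in A by lra.
  assert (shoot h c w (1 / 4) <= shoot h c w s) by (apply shoot_decr; auto).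
  unfold shoot in *. lra.
Qed.

Lemma shoot_drop (h : R -> R) (c m : R) (w : R -> R) :
  nonlinearity h -> cont w -> (forall s, 0 <= s <= 1 / 4 -> m <= w s) ->
  h m / 16 <= c - shoot h c w (1 / 2).
Proof.
  intros Hh Hw Hm.
  assert (A : 1 / 4 * (1 / 4) * h m <= J (fun x => h (w x)) (2 * (1 / 4))).
  { apply J_lower; try lra.
    - apply cont_comp; auto using nl_cont.
    - intros; apply nl_ge0; auto.
    - intros; apply nl_mono; auto. }
  replace (2 * (1 / 4)) with (1 / 2) in A by lra.
  unfold shoot. lra.
Qed.

Section Shooting.
Context (f g : R -> R) (Hf : nonlinearity f) (Hg : nonlinearity g).

Lemma sol_continuous2 (t a b : R) :
  0 <= t -> continuous2 (fun a b => sol f g a b t) a b.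
Proof.
  intros Ht.
  assert (H : continuous2 (fun a b => - sol f g a b t) a b).
  { apply corner_continuous.
    - intros. apply Ropp_le_contravar, sol_mono; auto.
    - intros e He.
      apply (is_lim_seq_opp _ (sol f g a b t)), sol_corner_lim; auto. }
  apply (continuous_ext (fun z : R * R => - - sol f g (fst z) (snd z) t)).
  - intros z. apply Ropp_involutive.
  - apply (continuous_opp (V := R_NormedModule)
      (fun z : R * R => - sol f g (fst z) (snd z) t)), H.
Qed.

Lemma sol_u_continuous2 (t a b : R) :
  0 <= t -> continuous2 (fun a b => sol_u f g a b t) a b.
Proof.
  intros Ht. apply corner_continuous.
  - intros a1 a2 b1 b2 Ha Hb.
    assert (a1 - a2 <= sol_u f g a1 b1 t - sol_u f g a2 b2 t)
      by (apply sol_u_mono; auto). lra.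
  - intros e He. apply sol_corner_lim; auto.
Qed.

(** For a given central value [b] of [v], some central value of [u] makes [u]
    vanish at time 1/2: for [a = 0] it is too small, and [a = f b / 4] exceeds
    the largest possible loss, as [v <= b]. *)
Lemma alpha_ex (b : R) : exists a, 0 <= a <= f b / 4 /\ sol_u f g a b (1 / 2) = 0.
Proof.
  pose proof (nl_ge0 f b Hf) as Pf.
  destruct (IVT_cor (fun a => sol_u f g a b (1 / 2)) 0 (f b / 4)) as [a [Ha E]].
  - intros a. apply continuity_pt_filterlim.
    apply (continuous_comp_2 (fun x : R => x) (fun _ => b)
      (fun x y => sol_u f g x y (1 / 2))).
    + apply continuous_id.
    + apply continuous_const.
    + apply sol_u_continuous2. lra.
  - lra.
  - assert (A : sol_u f g 0 b (1 / 2) <= 0) by (apply shoot_le; auto using sol_cont).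
    assert (B : 0 <= sol_u f g (f b / 4) b (1 / 2)).
    { unfold sol_u, shoot.
      assert (J (fun s => f (sol f g (f b / 4) b s)) (1 / 2) <= 1 / 2 * (1 / 2) * f b).
      { apply J_le_const; try lra.
        - apply cont_comp; auto using nl_cont, sol_cont.
        - intros x _. split; [apply nl_ge0; auto |]. apply nl_mono; auto.
          rewrite sol_eq by auto. apply shoot_le; auto using sol_u_cont. }
      lra. }
    nra.
  - exists a. auto.
Qed.

Definition alpha (b : R) : R :=
  proj1_sig (constructive_indefinite_description _ (alpha_ex b)).

Lemma alpha_spec (b : R) :
  0 <= alpha b <= f b / 4 /\ sol_u f g (alpha b) b (1 / 2) = 0.
Proof. exact (proj2_sig (constructive_indefinite_description _ (alpha_ex b))). Qed.

(** The expansion [sol_u_mono] bounds the variation of [alpha] by that of the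
    end value of [u] at fixed [a]. *)
Lemma alpha_cont : cont alpha.
Proof.
  intros b. apply continuous_eps. intros eps He.
  assert (C : continuous (fun y => sol_u f g (alpha b) y (1 / 2)) b).
  { apply (continuous_comp_2 (fun _ => alpha b) (fun y : R => y)
      (fun x y => sol_u f g x y (1 / 2))).
    + apply continuous_const.
    + apply continuous_id.
    + apply sol_u_continuous2. lra. }
  destruct (proj1 (continuous_eps _ _) C eps He) as [d [Hd HD]].
  exists d. split; auto. intros y Hy. specialize (HD y Hy).
  destruct (alpha_spec b) as [_ Eb]. destruct (alpha_spec y) as [_ Ey].
  rewrite Eb in HD. apply Rabs_lt_between in HD. apply Rabs_lt_between.
  destruct (Rle_dec (alpha y) (alpha b)) as [L | L].
  - assert (alpha b - alpha y <=
      sol_u f g (alpha b) y (1 / 2) - sol_u f g (alpha y) y (1 / 2))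
      by (apply sol_u_mono; auto; lra). lra.
  - assert (alpha y - alpha b <=
      sol_u f g (alpha y) y (1 / 2) - sol_u f g (alpha b) y (1 / 2))
      by (apply sol_u_mono; auto; lra). lra.
Qed.

(** Its positive zeros are the values of [v] at the centre for the even nontrivial
    solutions of the boundary value problem, since [u] already vanishes at
    time 1/2. *)
Definition endval (b : R) : R := sol f g (alpha b) b (1 / 2).

Lemma endval_cont : cont endval.
Proof.
  intros b. apply (continuous_comp_2 alpha (fun y : R => y)
    (fun x y => sol f g x y (1 / 2))).
  - apply alpha_cont.
  - apply continuous_id.
  - apply sol_continuous2. lra.
Qed.

(** While [v <= b], the component [u] loses at most [f b / 4] before time 1/2,
    so [alpha b] is at most that, and [v] loses at most [g (f b / 4) / 4]. *)
Lemma endval_pos (b : R) : g (f b / 4) / 4 < b -> 0 < endval b.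
Proof.
  intros Hb. unfold endval. rewrite sol_eq by auto. unfold shoot.
  destruct (alpha_spec b) as [Ha _].
  assert (J (fun s => g (sol_u f g (alpha b) b s)) (1 / 2)
    <= 1 / 2 * (1 / 2) * g (f b / 4)).
  { apply J_le_const; try lra.
    - apply cont_comp; auto using nl_cont, sol_u_cont.
    - intros x _. split; [apply nl_ge0; auto |]. apply nl_mono; auto.
      apply Rle_trans with (alpha b); [| lra].
      apply shoot_le; auto using sol_cont. }
  lra.
Qed.

(** If [v] were still nonnegative at time 1/2, then by concavity [v >= b / 2] up
    to time 1/4.  This makes [u] lose at least [f (b / 2) / 16], which is then a
    lower bound for [alpha b].  As [u] vanishes at time 1/2, again by concavity
    it is at least half of that up to time 1/4, and [v] loses more than [b]. *)
Lemma endval_neg (b : R) : b < g (f (b / 2) / 32) / 16 -> endval b < 0.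
Proof.
  intros Hb. apply Rnot_le_lt. intros C. unfold endval in C.
  destruct (alpha_spec b) as [_ Eu].
  set (a := alpha b) in *.
  assert (Cv : cont (sol f g a b)) by (apply sol_cont; auto).
  assert (Cu : cont (sol_u f g a b)) by (apply sol_u_cont; auto).
  assert (A : f (b / 2) / 16 <= a - sol_u f g a b (1 / 2)).
  { apply shoot_drop; auto. intros s Hs. rewrite sol_eq in C |- * by auto.
    apply shoot_mid; auto. }
  assert (B : g (a / 2) / 16 <= b - shoot g b (sol_u f g a b) (1 / 2)).
  { apply shoot_drop; auto. intros s Hs. apply shoot_mid; auto.
    change (0 <= sol_u f g a b (1 / 2)). lra. }
  rewrite <- sol_eq in B by auto.
  assert (g (f (b / 2) / 32) <= g (a / 2)) by (apply nl_mono; auto; lra).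
  lra.
Qed.

Lemma centred_solution (b1 b2 : R) :
  endval b1 * endval b2 < 0 -> b1 < b2 ->
  exists a b, b1 < b < b2 /\
    sol_u f g a b (1 / 2) = 0 /\ sol f g a b (1 / 2) = 0.
Proof.
  intros H Hb.
  destruct (IVT_cor endval b1 b2) as [b [Bb E]]; try lra.
  - intros b. apply continuity_pt_filterlim, endval_cont.
  - exists (alpha b), b. repeat split; [| | apply alpha_spec | exact E].
    + destruct (Req_dec b1 b) as [<- |]; [rewrite E in H |]; lra.
    + destruct (Req_dec b2 b) as [<- |]; [rewrite E in H |]; lra.
Qed.
End Shooting.

(** * Powers and classical solutions *)

(** Equal to [signed_pow s] on the nonnegative axis and cut off to 0 on the
    negative one. *)
Definition pos_pow (s x : R) : R := if Rlt_dec 0 x then Rpower x s else 0.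

Lemma pos_pow_pos (s x : R) : 0 < x -> pos_pow s x = Rpower x s.
Proof. intros H. unfold pos_pow. destruct (Rlt_dec 0 x); lra. Qed.

Lemma pos_pow_nonpos (s x : R) : x <= 0 -> pos_pow s x = 0.
Proof. intros H. unfold pos_pow. destruct (Rlt_dec 0 x); lra. Qed.

Lemma pos_pow_signed (s x : R) : 0 <= x -> pos_pow s x = signed_pow s x.
Proof.
  intros H. unfold signed_pow. destruct (Req_dec x 0) as [-> | N].
  - rewrite pos_pow_nonpos; lra.
  - rewrite pos_pow_pos, Rabs_pos_eq by lra.
    rewrite <- (Rpower_1 x) at 3 by lra. rewrite <- Rpower_plus.
    f_equal. ring.
Qed.

Lemma Rpower_is_derive (s x : R) :
  0 < x -> is_derive (fun y => Rpower y s) x (s * Rpower x (s - 1)).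
Proof. intros H. apply is_derive_Reals, derivable_pt_lim_power, H. Qed.

Lemma Rpower_cont (s x : R) : 0 < x -> continuous (fun y => Rpower y s) x.
Proof.
  intros H. apply (ex_derive_continuous (fun y => Rpower y s)).
  eexists. apply Rpower_is_derive, H.
Qed.

Lemma pos_pow_cont (s : R) : 0 < s -> cont (pos_pow s).
Proof.
  intros Hs x. destruct (Rlt_dec 0 x) as [P | N].
  - apply (continuous_ext_loc _ (fun y => Rpower y s)).
    + exists (mkposreal x P). intros y Hy. change (Rabs (y - x) < x) in Hy.
      apply Rabs_lt_between in Hy. rewrite pos_pow_pos; lra.
    + apply Rpower_cont, P.
  - apply continuous_eps. intros eps He.
    exists (Rpower eps (/ s)). split; [apply exp_pos |]. intros y Hy.
    apply Rabs_lt_between in Hy. rewrite (pos_pow_nonpos s x) by lra.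
    rewrite Rminus_0_r. destruct (Rlt_dec 0 y).
    + rewrite pos_pow_pos, Rabs_pos_eq by (auto; apply Rlt_le, exp_pos).
      replace eps with (Rpower (Rpower eps (/ s)) s).
      * apply Rlt_Rpower_l; lra.
      * rewrite Rpower_mult, Rinv_l, Rpower_1; lra.
    + rewrite pos_pow_nonpos, Rabs_R0; lra.
Qed.

Lemma pos_pow_nonlinearity (s : R) : 0 < s -> nonlinearity (pos_pow s).
Proof.
  intros Hs. split.
  - apply pos_pow_cont, Hs.
  - intros x y Hxy. unfold pos_pow. destruct (Rlt_dec 0 x), (Rlt_dec 0 y); try lra.
    + apply Rle_Rpower_l; lra.
    + apply Rlt_le, exp_pos.
  - intros x Hx. apply pos_pow_nonpos, Hx.
  - intros x Hx.
    destruct (proj1 (continuous_eps _ _) (Rpower_cont (s - 1) x Hx) 1 Rlt_0_1)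
      as [d [Hd HD]].
    pose proof (exp_pos ((s - 1) * ln x)) as Px.
    change (0 < Rpower x (s - 1)) in Px.
    exists (s * (Rpower x (s - 1) + 1)), (Rmin d x).
    pose proof (Rmin_l d x). pose proof (Rmin_r d x).
    repeat split; [nra | apply Rmin_pos; auto |].
    intros y z Hy Hz.
    apply Rabs_lt_between in Hy, Hz. rewrite !pos_pow_pos by lra.
    destruct (MVT_gen (fun t => Rpower t s) z y (fun t => s * Rpower t (s - 1)))
      as [c [Hc E]].
    + intros t Ht. apply Rpower_is_derive.
      revert Ht. unfold Rmin, Rmax in *. destruct (Rle_dec z y), (Rle_dec d x); lra.
    + intros t Ht. apply continuity_pt_filterlim, Rpower_cont.
      revert Ht. unfold Rmin, Rmax in *. destruct (Rle_dec z y), (Rle_dec d x); lra.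
    + rewrite E, Rabs_mult. apply Rmult_le_compat_r; [apply Rabs_pos |].
      assert (Dc : Rabs (c - x) < d).
      { apply Rabs_lt_between. revert Hc. unfold Rmin at 1, Rmax at 1.
        destruct (Rle_dec z y); lra. }
      specialize (HD c Dc). apply Rabs_lt_between in HD.
      assert (Pc : 0 < Rpower c (s - 1)) by apply exp_pos.
      rewrite Rabs_pos_eq by nra. apply Rmult_le_compat_l; lra.
Qed.

Lemma nonlinearity_comb (c : R) (h k : R -> R) :
  0 <= c -> nonlinearity h -> nonlinearity k ->
  nonlinearity (fun x => c * h x + k x).
Proof.
  intros Hc Hh Hk. split.
  - intros x. apply (continuous_plus (V := R_NormedModule) (fun y => c * h y) k);
      [| apply nl_cont; auto].
    apply (continuous_scal_r (V := R_NormedModule) c h), nl_cont, Hh.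
  - intros x y Hxy. apply Rplus_le_compat; [| apply nl_mono; auto].
    apply Rmult_le_compat_l; auto. apply nl_mono; auto.
  - intros x Hx. rewrite (nl_zero h Hh x Hx), (nl_zero k Hk x Hx). ring.
  - intros x Hx.
    destruct (nl_lip h Hh x Hx) as [L1 [d1 [PL1 [Pd1 H1]]]].
    destruct (nl_lip k Hk x Hx) as [L2 [d2 [PL2 [Pd2 H2]]]].
    pose proof (Rmin_l d1 d2). pose proof (Rmin_r d1 d2).
    exists (c * L1 + L2), (Rmin d1 d2).
    repeat split; [nra | apply Rmin_pos; auto |]. intros y z Hy Hz.
    specialize (H1 y z ltac:(lra) ltac:(lra)).
    specialize (H2 y z ltac:(lra) ltac:(lra)).
    replace (c * h y + k y - (c * h z + k z))
      with (c * (h y - h z) + (k y - k z)) by ring.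
    eapply Rle_trans; [apply Rabs_triang |].
    rewrite Rabs_mult, (Rabs_pos_eq c) by auto. nra.
Qed.

Lemma C2_shift (F F1 F2 : R -> R) (c : R) :
  (forall x, is_derive F x (F1 x)) -> (forall x, is_derive F1 x (F2 x)) ->
  cont F2 ->
  C2_open (fun x => F (x - c)) /\
  forall x, Derive_n (fun x => F (x - c)) 2 x = F2 (x - c).
Proof.
  intros H1 H2 C.
  assert (S : forall G G1 : R -> R, (forall x, is_derive G x (G1 x)) ->
    forall x, is_derive (fun x => G (x - c)) x (G1 (x - c))).
  { intros G G1 HG x. replace (G1 (x - c)) with (1 * G1 (x - c)) by ring.
    apply (is_derive_comp G (fun x => x - c)); auto.
    auto_derive; auto. }
  assert (E1 : forall x, Derive (fun x => F (x - c)) x = F1 (x - c)).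
  { intros x. apply is_derive_unique, S, H1. }
  assert (D2 : forall x, is_derive (Derive (fun x => F (x - c))) x (F2 (x - c))).
  { intros x. apply (is_derive_ext (fun x => F1 (x - c))).
    - intros t. symmetry. apply E1.
    - apply S, H2. }
  assert (E2 : forall x, Derive_n (fun x => F (x - c)) 2 x = F2 (x - c)).
  { intros x. apply is_derive_unique, D2. }
  split; auto.
  intros x _ k Hk.
  assert (K : k = 0%nat \/ k = 1%nat \/ k = 2%nat) by lia.
  destruct K as [-> | [-> | ->]]; split.
  - exact I.
  - apply (ex_derive_continuous (fun x => F (x - c))). eexists. apply S, H1.
  - eexists. apply S, H1.
  - apply (ex_derive_continuous (Derive (fun x => F (x - c)))). eexists. apply D2.
  - eexists. apply D2.
  - apply (continuous_ext (fun x => F2 (x - c))).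
    + intros t. symmetry. apply E2.
    + apply (cont_comp F2 (fun x => x - c)); auto.
      apply (cont_minus (fun x => x)); [| apply cont_const].
      intros t. apply continuous_id.
Qed.

Lemma shoot_C2 (h : R -> R) (c e : R) (w : R -> R) :
  nonlinearity h -> cont w ->
  C2_open (fun x => shoot h c w (x - e)) /\
  forall x, Derive_n (fun x => shoot h c w (x - e)) 2 x = - h (w (x - e)).
Proof.
  intros Hh Hw.
  assert (Ch : cont (fun s => h (w s))) by (apply cont_comp; auto using nl_cont).
  apply (C2_shift (shoot h c w) (fun x => - prim (fun s => h (w s)) x)
    (fun x => - h (w x))).
  - intros x. replace (- prim (fun s => h (w s)) x)
      with (0 - prim (fun s => h (w s)) x) by ring.
    apply (is_derive_minus (V := R_NormedModule) (fun _ => c)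
      (J (fun s => h (w s))) x 0).
    + apply (is_derive_const (V := R_NormedModule) c).
    + exact (prim_derive (prim (fun s => h (w s))) x (prim_cont _ Ch)).
  - intros x. apply (is_derive_opp (V := R_NormedModule) (prim (fun s => h (w s)))).
    exact (prim_derive (fun s => h (w s)) x Ch).
  - intros x. apply (continuous_opp (V := R_NormedModule) (fun s => h (w s))), Ch.
Qed.

Lemma shoot_ge_end (h : R -> R) (c t : R) (w : R -> R) :
  nonlinearity h -> cont w -> (forall s, w (- s) = w s) -> - (1 / 2) <= t <= 1 / 2 ->
  shoot h c w (1 / 2) <= shoot h c w t.
Proof.
  intros Hh Hw E Ht. destruct (Rle_dec 0 t).
  - apply shoot_decr; auto; lra.
  - rewrite <- (shoot_even h c w t) by auto. apply shoot_decr; auto; lra.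
Qed.

(** Shifting by 1/2 puts the centre of symmetry in the middle of the unit
    interval.  Both components decrease away from the centre and vanish at the
    ends, hence are nonnegative, and there the cut-off powers agree with the
    signed ones. *)
Lemma classical_of_centred (p q r lambda a b : R) :
  0 < p -> 0 < q -> 0 < r -> 0 < lambda ->
  let f := fun x => lambda * pos_pow r x + pos_pow p x in
  let g := pos_pow q in
  sol_u f g a b (1 / 2) = 0 -> sol f g a b (1 / 2) = 0 ->
  nonneg_classical_solution p q r lambda
    (fun x => sol_u f g a b (x - 1 / 2)) (fun x => sol f g a b (x - 1 / 2)).
Proof.
  intros hp hq hr hl f g Eu Ev.
  assert (Hf : nonlinearity f)
    by (apply nonlinearity_comb; auto using pos_pow_nonlinearity; lra).
  assert (Hg : nonlinearity g) by (apply pos_pow_nonlinearity; auto).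
  assert (Cv : cont (sol f g a b)) by (apply sol_cont; auto).
  assert (Cu : cont (sol_u f g a b)) by (apply sol_u_cont; auto).
  assert (Gv : forall t, - (1 / 2) <= t <= 1 / 2 -> 0 <= sol f g a b t).
  { intros t Ht. rewrite <- Ev, !(sol_eq f g) by auto.
    apply shoot_ge_end; auto using sol_u_even. }
  assert (Gu : forall t, - (1 / 2) <= t <= 1 / 2 -> 0 <= sol_u f g a b t).
  { intros t Ht. rewrite <- Eu.
    apply shoot_ge_end; auto using sol_even. }
  destruct (shoot_C2 f a (1 / 2) (sol f g a b)) as [C2u Du]; auto.
  destruct (shoot_C2 g b (1 / 2) (sol_u f g a b)) as [C2v Dv]; auto.
  assert (Xv : forall x, shoot g b (sol_u f g a b) (x - 1 / 2) = sol f g a b (x - 1 / 2)).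
  { intros x. symmetry. apply sol_eq; auto. }
  assert (Sh : forall w, cont w -> C0_closed (fun x => w (x - 1 / 2))).
  { intros w Hw. apply continuous_on_forall. intros x _.
    apply (cont_comp w (fun x => x - 1 / 2)); auto.
    apply (cont_minus (fun x => x)); [| apply cont_const].
    intros t. apply continuous_id. }
  assert (Dv' : forall k x, Derive_n (fun x => sol f g a b (x - 1 / 2)) k x
    = Derive_n (fun x => shoot g b (sol_u f g a b) (x - 1 / 2)) k x).
  { intros k x. apply Derive_n_ext. intros t. symmetry. apply Xv. }
  split.
  - exact C2u.
  - intros x Hx k Hk. destruct (C2v x Hx k Hk) as [A B]. split.
    + revert A. apply ex_derive_n_ext, Xv.
    + revert B. apply continuous_ext. intros t. symmetry. apply Dv'.
  - apply Sh, Cu.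
  - apply Sh, Cv.
  - intros x Hx. apply Gu. lra.
  - intros x Hx. apply Gv. lra.
  - intros x Hx. change (- Derive_n (fun x => shoot f a (sol f g a b) (x - 1 / 2)) 2 x
      = lambda * signed_pow r (sol f g a b (x - 1 / 2))
        + signed_pow p (sol f g a b (x - 1 / 2))).
    rewrite Du, Ropp_involutive. unfold f at 1.
    rewrite !pos_pow_signed by (apply Gv; lra). reflexivity.
  - intros x Hx. rewrite Dv', Dv, Ropp_involutive. unfold g at 1.
    apply pos_pow_signed, Gu. lra.
  - replace (0 - 1 / 2) with (- (1 / 2)) by lra.
    replace (1 - 1 / 2) with (1 / 2) by lra.
    rewrite sol_u_even by auto. auto.
  - replace (0 - 1 / 2) with (- (1 / 2)) by lra.
    replace (1 - 1 / 2) with (1 / 2) by lra.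
    rewrite sol_even by auto. auto.
Qed.

Lemma Rpower_neg_large (e C : R) :
  0 < e -> exists y, 0 < y < 1 / 2 /\ C < Rpower y (- e).
Proof.
  intros He. pose (D := Rmax 1 C).
  assert (HD : 1 <= D /\ C <= D) by (split; [apply Rmax_l | apply Rmax_r]).
  destruct (proj1 (continuous_eps _ _) (pos_pow_cont e He 0) (/ D)) as [d [Hd H]].
  { apply Rinv_0_lt_compat. lra. }
  pose proof (Rmin_l d (1 / 2)). pose proof (Rmin_r d (1 / 2)).
  assert (0 < Rmin d (1 / 2)) by (apply Rmin_pos; lra).
  set (y := Rmin d (1 / 2) / 2).
  assert (Hy : 0 < y < 1 / 2 /\ y < d) by (unfold y; lra).
  exists y. split; [tauto |].
  assert (A : Rabs (y - 0) < d) by (apply Rabs_lt_between; lra).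
  specialize (H y A). rewrite (pos_pow_nonpos e 0), pos_pow_pos in H by lra.
  apply Rabs_lt_between in H. rewrite Rpower_Ropp.
  apply Rle_lt_trans with (/ / D); [rewrite Rinv_inv; lra |].
  assert (0 < Rpower y e) by apply exp_pos.
  apply Rinv_lt_contravar; [| lra].
  apply Rmult_lt_0_compat; auto. apply Rinv_0_lt_compat. lra.
Qed.

Lemma Rpower_pos_large (e C : R) :
  0 < e -> exists y, 1 / 2 < y /\ C < Rpower y e.
Proof.
  intros He. destruct (Rpower_neg_large e C He) as [y [Hy HC]].
  exists (/ y). split.
  - apply Rlt_trans with 1; [lra |]. rewrite <- Rinv_1.
    apply Rinv_lt_contravar; lra.
  - rewrite <- (Rpower_1 y) by lra. rewrite <- Rpower_Ropp, Rpower_mult.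
    replace (- (1) * e) with (- e) by ring. exact HC.
Qed.

(** The condition of [endval_neg] at [b = 2 y].  When [f] dominates
    [c * y ^ s], the right-hand side is at least a constant times
    [y ^ (s * q)], and so exceeds a multiple of [y] as soon as
    [y ^ (s * q - 1)] is large: for small [y] if [s * q < 1], for large [y]
    if [s * q > 1]. *)
Lemma power_gap (f : R -> R) (c s q y : R) :
  0 < q -> 0 < c -> 0 < y -> c * Rpower y s <= f y ->
  32 * Rpower (32 / c) q < Rpower y (s * q - 1) ->
  2 * y < pos_pow q (f ((2 * y) / 2) / 32) / 16.
Proof.
  intros Hq Hc Hy Hf H.
  replace (2 * y / 2) with y by lra.
  assert (P1 : 0 < Rpower y s) by apply exp_pos.
  assert (P2 : 0 < c / 32) by lra.
  assert (P3 : 0 < c / 32 * Rpower y s) by (apply Rmult_lt_0_compat; auto).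
  assert (A : Rpower (c / 32) q * Rpower y (s * q) <= pos_pow q (f y / 32)).
  { rewrite pos_pow_pos by lra. rewrite <- Rpower_mult, Rpower_mult_distr by auto.
    apply Rle_Rpower_l; lra. }
  assert (B : Rpower (c / 32) q * Rpower (32 / c) q = 1).
  { rewrite Rpower_mult_distr; auto; [| apply Rdiv_lt_0_compat; lra].
    replace (c / 32 * (32 / c)) with 1 by (field; lra).
    unfold Rpower. rewrite ln_1, Rmult_0_r. apply exp_0. }
  assert (E : Rpower y (s * q) = Rpower y (s * q - 1) * y).
  { rewrite <- (Rpower_1 y) at 3 by auto. rewrite <- Rpower_plus. f_equal. ring. }
  rewrite E in A.
  assert (P4 : 0 < Rpower (c / 32) q * y)
    by (apply Rmult_lt_0_compat; auto; apply exp_pos).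
  assert (K : Rpower (c / 32) q * y * (32 * Rpower (32 / c) q)
    < Rpower (c / 32) q * y * Rpower y (s * q - 1))
    by (apply Rmult_lt_compat_l; auto).
  replace (Rpower (c / 32) q * y * (32 * Rpower (32 / c) q))
    with (32 * y * (Rpower (c / 32) q * Rpower (32 / c) q)) in K by ring.
  rewrite B in K. lra.
Qed.

Theorem theorem1 (p q r : R)
  (hp : 0 < p) (hq : 0 < q) (hr : 0 < r)
  (hrq : r < 1 / q) (hpq : Rmax 1 (1 / q) < p) :
  exists lambda0 : R, 0 < lambda0 /\
    forall lambda : R, 0 < lambda < lambda0 ->
      exists u1 v1 u2 v2 : R -> R,
        nonneg_classical_solution p q r lambda u1 v1 /\ nontrivial u1 v1 /\
        nonneg_classical_solution p q r lambda u2 v2 /\ nontrivial u2 v2 /\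
        ~ same_on_unit u1 v1 u2 v2.
Proof.
  exists 1. split; [lra |]. intros lambda Hl.
  set (f := fun x => lambda * pos_pow r x + pos_pow p x).
  set (g := pos_pow q).
  assert (Hf : nonlinearity f)
    by (apply nonlinearity_comb; auto using pos_pow_nonlinearity; lra).
  assert (Hg : nonlinearity g) by (apply pos_pow_nonlinearity; auto).
  assert (Hrq : r * q < 1).
  { apply Rmult_lt_reg_r with (/ q); [apply Rinv_0_lt_compat; auto |].
    rewrite Rmult_assoc, Rinv_r by lra. lra. }
  assert (Hpq : 1 < p * q).
  { pose proof (Rmax_r 1 (1 / q)).
    apply Rmult_lt_reg_r with (/ q); [apply Rinv_0_lt_compat; auto |].
    rewrite Rmult_assoc, Rinv_r by lra. lra. }
  assert (Pp : forall s y, 0 < y -> 0 < pos_pow s y).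
  { intros s y Hy. rewrite pos_pow_pos by auto. apply exp_pos. }
  (* At [b = 1] both powers equal 1, so [f 1 <= 2] and [g (f 1 / 4) <= 1]. *)
  assert (W1 : 0 < endval f g Hf Hg 1).
  { apply endval_pos.
    assert (One : forall s, pos_pow s 1 = 1).
    { intros s. rewrite pos_pow_pos by lra.
      unfold Rpower. rewrite ln_1, Rmult_0_r. apply exp_0. }
    assert (g (f 1 / 4) <= g 1).
    { apply nl_mono; auto. unfold f. rewrite !One. lra. }
    unfold g in *. rewrite One in H. lra. }
  destruct (Rpower_neg_large (1 - r * q) (32 * Rpower (32 / lambda) q))
    as [y [Hy Cy]]; [lra |].
  destruct (Rpower_pos_large (p * q - 1) (32 * Rpower (32 / 1) q))
    as [z [Hz Cz]]; [lra |].
  assert (Wy : endval f g Hf Hg (2 * y) < 0).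
  { apply endval_neg, (power_gap f lambda r); auto; try lra.
    - unfold f. pose proof (Pp p y). rewrite (pos_pow_pos r y); lra.
    - replace (r * q - 1) with (- (1 - r * q)) by ring. auto. }
  assert (Wz : endval f g Hf Hg (2 * z) < 0).
  { apply endval_neg, (power_gap f 1 p); auto; try lra.
    unfold f. pose proof (Pp r z ltac:(lra)).
    rewrite (pos_pow_pos p z) by lra. nra. }
  destruct (centred_solution f g Hf Hg (2 * y) 1) as [a1 [b1 [Hb1 [Eu1 Ev1]]]];
    [nra | lra |].
  destruct (centred_solution f g Hf Hg 1 (2 * z)) as [a2 [b2 [Hb2 [Eu2 Ev2]]]];
    [nra | lra |].
  assert (V0 : forall a b, sol f g a b (1 / 2 - 1 / 2) = b).
  { intros a b. rewrite Rminus_diag, sol_eq by auto. apply shoot_0. }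
  exists (fun x => sol_u f g a1 b1 (x - 1 / 2)), (fun x => sol f g a1 b1 (x - 1 / 2)).
  exists (fun x => sol_u f g a2 b2 (x - 1 / 2)), (fun x => sol f g a2 b2 (x - 1 / 2)).
  split; [apply classical_of_centred; auto; lra |].
  split.
  { intros H. destruct (H (1 / 2) ltac:(lra)) as [_ E]. rewrite V0 in E. lra. }
  split; [apply classical_of_centred; auto; lra |].
  split.
  { intros H. destruct (H (1 / 2) ltac:(lra)) as [_ E]. rewrite V0 in E. lra. }
  intros H. destruct (H (1 / 2) ltac:(lra)) as [_ E]. rewrite !V0 in E. lra.
Qed.
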